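(* Let $a$ be an arbitrary real number and $h(x)$ an arbitrary smooth function, and consider the system $$\dot x = -y, \qquad \dot y = (x + a^2 x^3)(1 + h(x) y)^3 + 3 a x y\,(1 + h(x) y)^2 - h'(x) y^3 .$$ In the variables $$X = x, \qquad Y = \frac{y}{1 + h(x) y}$$ (defined where $1+h(x)y \ne 0$) this system takes the form $$\lambda \dot X = -Y, \qquad \lambda \dot Y = X + 3 a X Y + a^2 X^3, \qquad \text{where } \lambda = 1 - h(X) Y,$$ i.e. it is collinear to the Kukles system $\dot X=-Y,\ \dot Y = X+3aXY+a^2X^3$. In particular, if $a=0$, the system reduces to (is collinear, with the factor $\lambda$, to) the harmonic oscillator: $\lambda\dot X=-Y,\ \lambda\dot Y = X$. Moreover, for all $a$ and $h$ the origin is an isochronous center of the original system.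
   Context: A singular point of a planar system is a center if some punctured neighborhood of it is filled with closed orbits (cycles) surrounding it. A center is isochronous if all cycles near it have the same period. The function $h$ is real-valued and smooth on an interval containing $0$. *)

(* Defs.v *)
(* MathComp-Analysis, over an arbitrary R : realType. *)
From mathcomp Require Export all_boot all_order all_algebra.
From mathcomp Require Export all_classical all_reals all_analysis.

Set Implicit Arguments.
Unset Strict Implicit.
Unset Printing Implicit Defensive.

Import Order.TTheory GRing.Theory Num.Theory.
Export numFieldNormedType.Exports.

Global Open Scope ring_scope.
Global Open Scope classical_set_scope.

Section PlanarSystems.
Variable R : realType.

(* I is meant to be open, so only the values of h on I matter. *)
Definition smooth_on (I : set R) (h : R -> R) : Prop :=
  forall (n : nat) (x : R), I x -> derivable (h^`(n)) x 1.

(* A planar system is its vector field F, considered on a domain D. *)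
Definition solution (D : set (R * R)) (F : R * R -> R * R)
    (J : set R) (c : R -> R * R) : Prop :=
  forall t, J t ->
    [/\ D (c t), is_derive t (1 : R) (fun s => (c s).1) (F (c t)).1
      & is_derive t (1 : R) (fun s => (c s).2) (F (c t)).2].

(* Solutions of the system  lam X' = (G (X, Y)).1,  lam Y' = (G (X, Y)).2. *)
Definition scaled_solution (E : set (R * R)) (lam : R * R -> R)
    (G : R * R -> R * R) (J : set R) (c : R -> R * R) : Prop :=
  forall t, J t ->
    [/\ E (c t),
        derivable (fun s => (c s).1) t 1,
        derivable (fun s => (c s).2) t 1,
        lam (c t) * derive1 (fun s => (c s).1) t = (G (c t)).1
      & lam (c t) * derive1 (fun s => (c s).2) t = (G (c t)).2].

Definition collinear (E : set (R * R)) (lam : R * R -> R)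
    (V W : R * R -> R * R) : Prop :=
  forall P, E P -> lam P != 0 /\ lam P *: V P = W P.

(* V is the expression of the vector field F in the variables P = Phi p. *)
Definition transforms_into (Phi : R * R -> R * R) (D E : set (R * R))
    (F V : R * R -> R * R) : Prop :=
  set_bij D E Phi /\
  forall p, D p -> differentiable Phi p /\ 'd Phi p (F p) = V (Phi p).

(* In the variables P = Phi p, the system p' = F p on D takes the form
   lam P' = G P on E: both as an equivalence between solutions (on open time
   intervals) and as collinearity of the transformed vector field with G. *)
Definition takes_collinear_form (Phi : R * R -> R * R) (lam : R * R -> R)
    (D E : set (R * R)) (F G : R * R -> R * R) : Prop :=
  (forall (J : set R) (c : R -> R * R), open J -> is_interval J ->
     (forall t, J t -> D (c t)) ->
     (solution D F J c <-> scaled_solution E lam G J (Phi \o c))) /\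
  (exists V : R * R -> R * R,
     transforms_into Phi D E F V /\ collinear E lam V G).

Definition has_period (c : R -> R * R) (T : R) : Prop :=
  0 < T /\ forall t, c (t + T) = c t.

(* "The" period of a periodic solution is the least positive one; its
   existence excludes constant solutions. *)
Definition least_period (c : R -> R * R) (T : R) : Prop :=
  has_period c T /\ forall S, has_period c S -> T <= S.

Definition cycle_of_period (D : set (R * R)) (F : R * R -> R * R)
    (T : R) (C : set (R * R)) : Prop :=
  exists c : R -> R * R,
    [/\ solution D F setT c, least_period c T & C = range c].

(* p lies inside C: off C, in a bounded component of its complement. *)
Definition surrounds (C : set (R * R)) (p : R * R) : Prop :=
  ~ C p /\ bounded_set (connected_component (~` C) p).

Definition singular_point (D : set (R * R)) (F : R * R -> R * R)
    (p : R * R) : Prop := D p /\ F p = (0, 0).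

Definition center (D : set (R * R)) (F : R * R -> R * R) (p : R * R) : Prop :=
  singular_point D F p /\
  exists2 U : set (R * R), nbhs p U &
    forall q, U q -> q <> p ->
      exists T : R, exists C : set (R * R),
        [/\ cycle_of_period D F T C, C q, C `<=` U & surrounds C p].

Definition isochronous_center (D : set (R * R)) (F : R * R -> R * R)
    (p : R * R) : Prop :=
  center D F p /\
  exists T : R, exists2 V : set (R * R), nbhs p V &
    forall (S : R) (C : set (R * R)),
      C `<=` V -> cycle_of_period D F S C -> S = T.

Definition original_system (a : R) (h : R -> R) (p : R * R) : R * R :=
  let x := p.1 in let y := p.2 in
  (- y,
   (x + a ^+ 2 * x ^+ 3) * (1 + h x * y) ^+ 3
   + 3 * a * x * y * (1 + h x * y) ^+ 2 - derive1 h x * y ^+ 3).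

Definition kukles_system (a : R) (P : R * R) : R * R :=
  let X := P.1 in let Y := P.2 in
  (- Y, X + 3 * a * X * Y + a ^+ 2 * X ^+ 3).

Definition harmonic_oscillator (P : R * R) : R * R := (- P.2, P.1).

Definition new_variables (h : R -> R) (p : R * R) : R * R :=
  (p.1, p.2 / (1 + h p.1 * p.2)).

Definition collinearity_factor (h : R -> R) (P : R * R) : R :=
  1 - h P.1 * P.2.

Definition phase_space (I : set R) : set (R * R) := [set p | I p.1].

Definition variables_domain (I : set R) (h : R -> R) : set (R * R) :=
  [set p | I p.1 /\ 1 + h p.1 * p.2 != 0].

Definition variables_range (I : set R) (h : R -> R) : set (R * R) :=
  [set P | I P.1 /\ collinearity_factor h P != 0].

End PlanarSystems.

(* Main.v *)
Require Import Defs.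
From mathcomp Require Import ring lra.

(* The Kukles system is conjugate to the harmonic oscillator u' = v, v' = -u
   by the rational map u = X / Q, v = - (Y + a X^2) / Q, where
   Q = 1 + a Y + a^2 X^2; its inverse is X = u / (1 + a v),
   Y = - (v + a (u^2 + v^2)) / (1 + a v)^2. Near the origin the orbits of the
   original system are therefore reparametrized rotations by an angle s with
   dt = lambda ds. As lambda = 1 - h(X) Y and dX/ds = - Y, this integrates to
   t = s + H(X) with H a primitive of h. Since X returns to its value after a
   full turn, every turn takes time exactly 2 pi. *)

Set Implicit Arguments.
Unset Strict Implicit.
Unset Printing Implicit Defensive.

Import Order.TTheory GRing.Theory Num.Theory.

(** * Elementary facts on derivatives of real functions *)

Lemma is_derive_div (R : realType) (f g : R -> R) (t df dg : R) :
  is_derive t 1 f df -> is_derive t 1 g dg -> g t != 0 ->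
  is_derive t 1 (fun s => f s / g s) ((df * g t - f t * dg) / g t ^+ 2).
Proof.
move=> Df Dg gt0.
have Dv := is_deriveV gt0 Dg.
apply: (is_derive_eq (is_deriveM Df Dv)).
by rewrite /GRing.scale /=; field.
Qed.

Lemma smooth_continuous (R : realType) (I : set R) (h : R -> R) (x : R) :
  smooth_on I h -> I x -> {for x, continuous h}.
Proof.
by move=> h_smooth /(h_smooth 0%N)/derivable1_diffP/differentiable_continuous.
Qed.

Lemma smooth_derive (R : realType) (I : set R) (h : R -> R) (x : R) :
  smooth_on I h -> I x -> is_derive x 1 h (derive1 h x).
Proof.
move=> h_smooth /(h_smooth 0%N) dh; split; first exact: dh.
by rewrite derive1E.
Qed.

(** * The change of variables, its inverse, and collinearity with the Kukles system *)

Definition old_variables (R : realType) (h : R -> R) (P : R * R) : R * R :=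
  (P.1, P.2 / collinearity_factor h P).

Section Collinearity.
Context (R : realType) (a : R) (I : set R) (h : R -> R).
Hypothesis h_smooth : smooth_on I h.

Local Notation Phi := (new_variables h).
Local Notation lam := (collinearity_factor h).
Local Notation D := (variables_domain I h).
Local Notation E := (variables_range I h).
Local Notation F := (original_system a h).
Local Notation G := (kukles_system a).

(** Because [1 - h y / (1 + h y) = 1 / (1 + h y)], lambda is the reciprocal of the denominator in
    the change of variables. Solving for [y] then gives [y = Y / lambda], the formula of
    [old_variables]. *)
Lemma factor_new_variables p : 1 + h p.1 * p.2 != 0 ->
  lam (Phi p) = (1 + h p.1 * p.2)^-1.
Proof. by move=> m0; rewrite /collinearity_factor /=; field. Qed.

Lemma new_variables_range p : D p -> E (Phi p).
Proof.
by move=> [Ip m0]; split => //; rewrite factor_new_variables// invr_eq0.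
Qed.

Lemma old_variables_domain P : E P -> D (old_variables h P).
Proof.
move=> [IP l0]; split => //=.
move: l0; rewrite /collinearity_factor => l0.
have -> : 1 + h P.1 * (P.2 / (1 - h P.1 * P.2)) = (1 - h P.1 * P.2)^-1.
  by field.
by rewrite invr_eq0.
Qed.

Lemma new_variablesK p : D p -> old_variables h (Phi p) = p.
Proof.
case: p => x y [_ m0]; rewrite /old_variables factor_new_variables//=.
by rewrite /= in m0; congr pair; field.
Qed.

Lemma old_variablesK P : E P -> Phi (old_variables h P) = P.
Proof.
case: P => X Y [_]; rewrite /collinearity_factor /= => l0.
rewrite /new_variables /old_variables /collinearity_factor /=; congr pair.
(* The second side condition left by [field] is a sum that collapses to 1. *)
by field; rewrite l0 /= mulrC subrK oner_eq0.
Qed.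

(** In the quotient rule the terms [h y y'] cancel. Along the original system [x' = - y], so the
    remaining term in [h'] compensates the summand [- h' y^3] of [y']. *)
Lemma is_derive_new_variable (c : R -> R * R) (t dx dy : R) :
  D (c t) ->
  is_derive t 1 (fun s => (c s).1) dx -> is_derive t 1 (fun s => (c s).2) dy ->
  is_derive t 1 (fun s => (Phi (c s)).2)
    ((dy - derive1 h (c t).1 * dx * (c t).2 ^+ 2)
     / (1 + h (c t).1 * (c t).2) ^+ 2).
Proof.
move=> [It m0] dc1 dc2.
have dh := smooth_derive h_smooth It.
have dhc : is_derive t 1 (fun s => h (c s).1) (derive1 h (c t).1 * dx).
  exact: is_derive1_comp dh dc1.
have dm : is_derive t 1 (fun s => 1 + h (c s).1 * (c s).2)
  (h (c t).1 * dy + (c t).2 * (derive1 h (c t).1 * dx)).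
  have d1 := is_derive_cst (1 : R) t 1.
  apply: (is_derive_eq (is_deriveD d1 (is_deriveM dhc dc2))).
  by rewrite add0r.
have dq := is_derive_div dc2 dm m0.
apply: (is_derive_eq dq).
by field.
Qed.

Lemma is_derive_old_variable (C : R -> R * R) (t dX dY : R) :
  E (C t) ->
  is_derive t 1 (fun s => (C s).1) dX -> is_derive t 1 (fun s => (C s).2) dY ->
  is_derive t 1 (fun s => (old_variables h (C s)).2)
    ((dY + derive1 h (C t).1 * dX * (C t).2 ^+ 2) / lam (C t) ^+ 2).
Proof.
move=> [It m0] dc1 dc2.
have dh := smooth_derive h_smooth It.
have dhc : is_derive t 1 (fun s => h (C s).1) (derive1 h (C t).1 * dX).
  exact: is_derive1_comp dh dc1.
have dm : is_derive t 1 (fun s => lam (C s))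
  (- (h (C t).1 * dY + (C t).2 * (derive1 h (C t).1 * dX))).
  have d1 := is_derive_cst (1 : R) t 1.
  apply: (is_derive_eq (is_deriveB d1 (is_deriveM dhc dc2))).
  by rewrite sub0r.
have dq := is_derive_div dc2 dm m0.
apply: (is_derive_eq dq).
rewrite /collinearity_factor in m0 *.
by field.
Qed.

Lemma solution_scaled_solution (J : set R) (c : R -> R * R) :
  (forall t, J t -> D (c t)) ->
  solution D F J c -> scaled_solution E lam G J (Phi \o c).
Proof.
move=> Dc solc t Jt; have [Dct dx dy] := solc t Jt.
have dY := is_derive_new_variable Dct dx dy.
have [_ m0] := Dct.
split.
- exact: new_variables_range.
- by case: dx.
- by case: dY.
- rewrite derive1E (@derive_val _ _ _ _ _ _ _ dx) /= factor_new_variables//.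
  by field.
- rewrite derive1E (@derive_val _ _ _ _ _ _ _ dY) /= factor_new_variables//.
  by field.
Qed.

Lemma scaled_solution_solution (J : set R) (c : R -> R * R) :
  open J -> (forall t, J t -> D (c t)) ->
  scaled_solution E lam G J (Phi \o c) -> solution D F J c.
Proof.
move=> J_open Dc solC t Jt; have [Et dX dY eX eY] := solC t Jt.
move/derivableP: dX => dX; move/derivableP: dY => dY.
rewrite -derive1E in dX; rewrite -derive1E in dY.
have := is_derive_old_variable Et dX dY.
have Dct := Dc t Jt; have [_ m0] := Dct.
move: eX eY; rewrite /= factor_new_variables//.
set X' := derive1 _ t; set Y' := derive1 _ t => eX eY.
have {}eX : X' = - (c t).2.
  rewrite -[LHS](mulKf (x := (1 + h (c t).1 * (c t).2)^-1)) ?invr_eq0// eX.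
  by field.
have {}eY : Y' = (1 + h (c t).1 * (c t).2) * (G (Phi (c t))).2.
  rewrite -[LHS](mulKf (x := (1 + h (c t).1 * (c t).2)^-1)) ?invr_eq0// eY.
  by rewrite invrK.
move=> dy; split => //.
- by rewrite /= -eX.
(* The curve is recovered from its new variables only at times in [J]. As [J] is open, this covers a
   neighborhood of [t], enough to transfer the derivative. *)
- apply: (@near_eq_is_derive _ _ _ (fun s => (old_variables h (Phi (c s))).2)).
    apply: filterS (open_nbhs_nbhs (conj J_open Jt)) => s Js.
    by rewrite new_variablesK//; exact: Dc.
  apply: (is_derive_eq dy).
by rewrite eY eX /=; field.
Qed.

Lemma is_diff_linear (U V : normedModType R) (f : {linear U -> V}) (p : U) :
  continuous f -> is_diff p f f.
Proof.
by move=> cf; split; [exact: linear_differentiable | exact: diff_lin].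
Qed.

(** Transforming the vector field requires the total differential rather than derivatives along
    curves. The formula is the same, with the increment [w] in place of the velocity. *)
Lemma is_diff_new_variable p : D p ->
  is_diff p (fun q => (Phi q).2)
    (fun w => (w.2 - derive1 h p.1 * w.1 * p.2 ^+ 2)
              / (1 + h p.1 * p.2) ^+ 2).
Proof.
move=> [Ip m0].
have d1 : is_diff p (fun q : R * R => q.1) (fun q => q.1).
  by apply: (@is_diff_linear _ _ (@fst R R)) => q; exact: cvg_fst.
have d2 : is_diff p (fun q : R * R => q.2) (fun q => q.2).
  by apply: (@is_diff_linear _ _ (@snd R R)) => q; exact: cvg_snd.
have dh : is_diff (p.1) h (fun w => w *: derive1 h p.1).
  have /derivable1_diffP dh := @h_smooth 0%N _ Ip.
  by split => //; rewrite diff1E.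
have dhp : is_diff p (fun q : R * R => h q.1) (fun w => w.1 *: derive1 h p.1).
  exact: is_diff_comp d1 dh.
have dm : is_diff p (fun q : R * R => 1 + h q.1 * q.2)
   (fun w => h p.1 * w.2 + p.2 * (w.1 * derive1 h p.1)).
  apply: (is_diff_eq (is_diffD (is_diff_cst (1 : R) p) (is_diffM dhp d2))).
  by rewrite add0r.
have di : is_diff p (fun q : R * R => (1 + h q.1 * q.2)^-1)
   (- (1 + h p.1 * p.2) ^- 2
    *: (fun w => h p.1 * w.2 + p.2 * (w.1 * derive1 h p.1))).
  case: dm => dm em; split; first exact: differentiableV.
  by rewrite diffV// em.
apply: (is_diff_eq (is_diffM d2 di)).
apply/funext => w.
transitivity (p.2 * (- (1 + h p.1 * p.2) ^- 2
    * (h p.1 * w.2 + p.2 * (w.1 * derive1 h p.1)))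
  + (1 + h p.1 * p.2)^-1 * w.2); first by [].
by field.
Qed.

Lemma collinear_form : takes_collinear_form Phi lam D E F G.
Proof.
split=> [J c J_open _ Dc|].
  by split; [exact: solution_scaled_solution|exact: scaled_solution_solution].
(* Collinearity forces the transformed field to be [G] divided by [lam]; what has to be checked is
   that the differential of [Phi] does produce it. *)
exists (fun P => (lam P)^-1 *: G P); split; last first.
  by move=> P [_ l0]; split => //; rewrite scalerA mulfV// scale1r.
split.
  split.
  - by move=> p; exact: new_variables_range.
  - move=> p q /set_mem Dp /set_mem Dq e.
    by rewrite -(new_variablesK Dp) e new_variablesK.
  - move=> P EP; exists (old_variables h P); first exact: old_variables_domain.
    exact: old_variablesK.
move=> p Dp; have d2 := is_diff_new_variable Dp.
have d1 : is_diff p (fun q : R * R => q.1) (fun q => q.1).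
  by apply: (@is_diff_linear _ _ (@fst R R)) => q; exact: cvg_fst.
have [dP eP] := is_diff_pair d1 d2.
have [_ m0] := Dp.
split; first exact: dP.
rewrite (eP : 'd Phi p = _ :> (_ -> _)) factor_new_variables// invrK.
by congr pair; rewrite /= /GRing.scale /=; field.
Qed.

End Collinearity.

(** * Rotations of the plane *)

Definition sqnorm (R : realType) (q : R * R) : R := q.1 ^+ 2 + q.2 ^+ 2.

(** The flow of [u' = v], [v' = - u] at time [s]: a clockwise rotation. *)
Definition rotation (R : realType) (s : R) (q : R * R) : R * R :=
  (q.1 * cos s + q.2 * sin s, q.2 * cos s - q.1 * sin s).

Section Rotation.
Context (R : realType).
Implicit Types (s t : R) (q : R * R).

Lemma sqnorm_gt0 q : (0 < sqnorm q) = (q != (0, 0)).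
Proof.
case: q => u v; rewrite /sqnorm lt_neqAle addr_ge0 ?sqr_ge0// andbT eq_sym.
by rewrite /= paddr_eq0 ?sqr_ge0// !sqrf_eq0.
Qed.

Lemma sqnorm_rotation s q : sqnorm (rotation s q) = sqnorm q.
Proof.
rewrite /sqnorm /rotation /=.
transitivity ((q.1 ^+ 2 + q.2 ^+ 2) * (cos s ^+ 2 + sin s ^+ 2)); first by ring.
by rewrite cos2Dsin2 mulr1.
Qed.

Lemma rotationD s t q : rotation (s + t) q = rotation s (rotation t q).
Proof. by rewrite /rotation cosD sinD /=; congr pair; ring. Qed.

Lemma rotation0 q : rotation 0 q = q.
Proof.
by case: q => u v; rewrite /rotation cos0 sin0 !mulr0 !mulr1 addr0 subr0.
Qed.

Lemma rotation2pi q : rotation (pi *+ 2) q = q.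
Proof.
by case: q => u v; rewrite /rotation cos2pi sin2pi !mulr0 !mulr1 addr0 subr0.
Qed.

Lemma is_derive_rotation1 s q :
  is_derive s 1 (fun x => (rotation x q).1) (rotation s q).2.
Proof.
rewrite /rotation /=.
have d1 := is_deriveM (is_derive_cst q.1 s 1) (is_derive_cos s).
have d2 := is_deriveM (is_derive_cst q.2 s 1) (is_derive_sin s).
apply: (is_derive_eq (is_deriveD d1 d2)).
by rewrite /cst !scaler0 !addr0 /GRing.scale /=; ring.
Qed.

Lemma is_derive_rotation2 s q :
  is_derive s 1 (fun x => (rotation x q).2) (- (rotation s q).1).
Proof.
rewrite /rotation /=.
have d1 := is_deriveM (is_derive_cst q.2 s 1) (is_derive_cos s).
have d2 := is_deriveM (is_derive_cst q.1 s 1) (is_derive_sin s).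
apply: (is_derive_eq (is_deriveB d1 d2)).
by rewrite /cst !scaler0 !addr0 /GRing.scale /=; ring.
Qed.

(** The angle [acos x] has sine [|y|]; the sign of [y] decides between it and its opposite. *)
Lemma cos_sin_surj (x y : R) : x ^+ 2 + y ^+ 2 = 1 ->
  exists s, cos s = x /\ sin s = y.
Proof.
move=> xy1.
have x1 : -1 <= x <= 1.
  by rewrite -ler_norml -(@ler_sqr _ `|x|) ?nnegrE// real_normK ?num_real//;
     rewrite expr1n -xy1 lerDl sqr_ge0.
have sE : sin (acos x) = `|y|.
  by rewrite sin_acos// -xy1 addrC addKr sqrtr_sqr.
have [y0|y0] := leP 0 y.
  by exists (acos x); rewrite acosK ?in_itv// sE ger0_norm.
exists (- acos x); rewrite cosN sinN acosK ?in_itv// sE.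
by rewrite ltr0_norm// opprK.
Qed.

Lemma rotation_transitive q q' : 0 < sqnorm q -> sqnorm q' = sqnorm q ->
  exists s, q' = rotation s q.
Proof.
move=> q0 qq'.
(* The cosine and sine of the angle between the two vectors, as dot and cross products over the
   squared norm. Lagrange's identity makes their squares add up to 1. *)
have [|s [cs ss]] := @cos_sin_surj ((q'.1 * q.1 + q'.2 * q.2) / sqnorm q)
  ((q'.1 * q.2 - q'.2 * q.1) / sqnorm q).
  rewrite !expr_div_n -mulrDl.
  transitivity (sqnorm q' * sqnorm q / sqnorm q ^+ 2).
    by congr (_ / _); rewrite /sqnorm; ring.
  by rewrite qq' -expr2 divff// expf_neq0// gt_eqF.
exists s; rewrite /rotation cs ss [LHS]surjective_pairing.
move/gt_eqF: q0 => /negbT; rewrite /sqnorm => q0.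
by congr pair; field.
Qed.

(** Pairing [rotation s q - q] with [q] gives [(cos s - 1) * sqnorm q], so a fixed nonzero point
    forces [cos s = 1]. But [cos s = 1 - 2 sin(s/2)^2], and [sin(s/2) > 0] when [0 < s < 2 pi]. *)
Lemma rotation_fix s q : 0 < sqnorm q -> 0 < s -> rotation s q = q ->
  pi *+ 2 <= s.
Proof.
move=> q0 s0 e; rewrite leNgt; apply/negP => s2.
have cs : cos s = 1.
  have : (cos s - 1) * sqnorm q = 0.
    have e1 : (rotation s q).1 = q.1 by rewrite e.
    have e2 : (rotation s q).2 = q.2 by rewrite e.
    transitivity (q.1 * ((rotation s q).1 - q.1)
                  + q.2 * ((rotation s q).2 - q.2)).
      by rewrite /rotation /sqnorm /=; ring.
    by rewrite e1 e2 !subrr !mulr0 addr0.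
  by move=> /eqP; rewrite mulf_eq0 (gt_eqF q0) orbF subr_eq0 => /eqP.
have sh : 0 < sin (s / 2).
  by apply: sin_gt0_pi; rewrite divr_gt0//= ltr_pdivrMr// mulr_natr.
have : cos s = 1 - sin (s / 2) ^+ 2 *+ 2.
  by rewrite {1}(splitr s) cosD -!expr2 cos2sin2 mulr2n opprD addrA.
rewrite cs => /eqP; rewrite eq_sym -subr_eq0 addrAC subrr add0r oppr_eq0.
by rewrite mulrn_eq0/= expf_eq0/= (gt_eqF sh).
Qed.

End Rotation.

(** * Linearization of the Kukles system *)

Definition kukles_of_linear (R : realType) (a : R) (q : R * R) : R * R :=
  (q.1 / (1 + a * q.2), - (q.2 + a * sqnorm q) / (1 + a * q.2) ^+ 2).

Definition kukles_denominator (R : realType) (a : R) (P : R * R) : R :=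
  1 + a * P.2 + (a * P.1) ^+ 2.

Definition linear_of_kukles (R : realType) (a : R) (P : R * R) : R * R :=
  (P.1 / kukles_denominator a P,
   - (P.2 + a * P.1 ^+ 2) / kukles_denominator a P).

Section Linearization.
Context (R : realType) (a : R).
Local Notation K := (kukles_of_linear a).
Local Notation L := (linear_of_kukles a).
Local Notation Q := (kukles_denominator a).

(** The denominators of the two rational maps are reciprocal at corresponding points, so each map
    sends its own domain into that of the other. *)
Lemma kukles_denominator_linear q : 1 + a * q.2 != 0 ->
  Q (K q) = (1 + a * q.2)^-1.
Proof.
by move=> m0; rewrite /kukles_denominator /kukles_of_linear /sqnorm /=; field.
Qed.

Lemma kukles_of_linearK q : 1 + a * q.2 != 0 -> L (K q) = q.
Proof.
move=> m0; rewrite /linear_of_kukles kukles_denominator_linear//.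
rewrite [RHS]surjective_pairing /kukles_of_linear /sqnorm /=.
by congr pair; field.
Qed.

Lemma linear_of_kuklesK P : Q P != 0 -> K (L P) = P.
Proof.
move=> Q0; rewrite /kukles_of_linear.
have e : 1 + a * (L P).2 = (Q P)^-1.
  rewrite /linear_of_kukles /=.
  rewrite /kukles_denominator in Q0 *.
  by field.
rewrite e [RHS]surjective_pairing /sqnorm /linear_of_kukles /=.
move: Q0; rewrite /kukles_denominator => Q0.
by congr pair; field.
Qed.

(** The factor [r] allows for a change of time. The key identity is [Q' = r a X Q]: the curve
    [Q = 0] is invariant with cofactor [a X], and dividing by [Q] removes the nonlinear terms. *)
Lemma is_derive_linear_of_kukles (C : R -> R * R) (t r : R) :
  Q (C t) != 0 ->
  is_derive t 1 (fun s => (C s).1) (r * (kukles_system a (C t)).1) ->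
  is_derive t 1 (fun s => (C s).2) (r * (kukles_system a (C t)).2) ->
  is_derive t 1 (fun s => (L (C s)).1) (r * (L (C t)).2) /\
  is_derive t 1 (fun s => (L (C s)).2) (- (r * (L (C t)).1)).
Proof.
move=> Q0 d1 d2.
have dX2 : is_derive t 1 (fun s => (C s).1 ^+ 2)
    (2 * (C t).1 * (r * (kukles_system a (C t)).1)).
  apply: (is_derive_eq (is_deriveX 2 d1)).
  by rewrite /GRing.scale /= expr1.
have dQ : is_derive t 1 (fun s => Q (C s)) (r * a * (C t).1 * Q (C t)).
  have e1 := is_deriveM (is_derive_cst a t 1) d2.
  have e3 : is_derive t 1 (fun s => a * (C s).1)
      (a * (r * (kukles_system a (C t)).1)).
    apply: (is_derive_eq (is_deriveM (is_derive_cst a t 1) d1)).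
    by rewrite /cst scaler0 addr0.
  have e2 : is_derive t 1 (fun s => (a * (C s).1) ^+ 2)
      (2 * (a * (C t).1) * (a * (r * (kukles_system a (C t)).1))).
    apply: (is_derive_eq (is_deriveX 2 e3)).
    by rewrite /GRing.scale /= expr1.
  have e0 := is_deriveD (is_derive_cst (1 : R) t 1) e1.
  apply: (is_derive_eq (is_deriveD e0 e2)).
  rewrite /cst !scaler0 !addr0 add0r /GRing.scale /= /kukles_denominator.
  by ring.
have dN : is_derive t 1 (fun s => - ((C s).2 + a * (C s).1 ^+ 2))
    (- (r * (kukles_system a (C t)).2
        + a * (2 * (C t).1 * (r * (kukles_system a (C t)).1)))).
  have e2 := is_deriveM (is_derive_cst a t 1) dX2.
  apply: (is_derive_eq (is_deriveN (is_deriveD d2 e2))).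
  by rewrite /cst !scaler0 !addr0.
have dU := is_derive_div d1 dQ Q0.
have dV := is_derive_div dN dQ Q0.
split.
- apply: (is_derive_eq dU).
  rewrite /linear_of_kukles /=; move: Q0; rewrite /kukles_denominator => Q0.
  by field.
- apply: (is_derive_eq dV).
  rewrite /linear_of_kukles /=; move: Q0; rewrite /kukles_denominator => Q0.
  by field.
Qed.

(** The linear flow preserves [sqnorm], so in the numerator of [Y] only the term [v] contributes to
    the derivative. *)
Lemma is_derive_kukles_of_linear (q : R -> R * R) (t r : R) :
  1 + a * (q t).2 != 0 ->
  is_derive t 1 (fun s => (q s).1) (r * (q t).2) ->
  is_derive t 1 (fun s => (q s).2) (- (r * (q t).1)) ->
  is_derive t 1 (fun s => (K (q s)).1) (r * (kukles_system a (K (q t))).1) /\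
  is_derive t 1 (fun s => (K (q s)).2) (r * (kukles_system a (K (q t))).2).
Proof.
move=> m0 d1 d2.
have dm : is_derive t 1 (fun s => 1 + a * (q s).2) (- (a * r * (q t).1)).
  have e1 := is_deriveM (is_derive_cst a t 1) d2.
  apply: (is_derive_eq (is_deriveD (is_derive_cst (1 : R) t 1) e1)).
  by rewrite /cst !scaler0 !addr0 add0r /GRing.scale /=; ring.
have dm2 : is_derive t 1 (fun s => (1 + a * (q s).2) ^+ 2)
    (2 * (1 + a * (q t).2) * (- (a * r * (q t).1))).
  apply: (is_derive_eq (is_deriveX 2 dm)).
  by rewrite /GRing.scale /= expr1.
have dn : is_derive t 1 (fun s => sqnorm (q s)) 0.
  apply: (is_derive_eq (is_deriveD (is_deriveX 2 d1) (is_deriveX 2 d2))).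
  by rewrite /GRing.scale /= !expr1; ring.
have dN : is_derive t 1 (fun s => - ((q s).2 + a * sqnorm (q s))) (r * (q t).1).
  have e2 := is_deriveM (is_derive_cst a t 1) dn.
  apply: (is_derive_eq (is_deriveN (is_deriveD d2 e2))).
  by rewrite /cst !scaler0 !addr0 opprK.
have dU := is_derive_div d1 dm m0.
have dV := is_derive_div dN dm2 (expf_neq0 2 m0).
split.
- by apply: (is_derive_eq dU); rewrite /kukles_of_linear /sqnorm /=; field.
- by apply: (is_derive_eq dV); rewrite /kukles_of_linear /sqnorm /=; field.
Qed.

End Linearization.

(** * A local primitive of [h], and a disc on which all coordinates are valid *)

Lemma primitive_near0 (R : realType) (I : set R) (h : R -> R) :
  open I -> I 0 -> {in I, continuous h} ->
  exists H : R -> R, \forall x \near (0 : R), is_derive x (1 : R) H (h x).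
Proof.
move=> I_open I0 hc.
have /nbhs_ballP[e /= e0 eI] := open_nbhs_nbhs (conj I_open I0).
(* Halving the radius keeps the closed segment from [- d] to [d] inside [I]. *)
pose d := e / 2.
have d0 : 0 < d by rewrite divr_gt0.
have dI x : `[- d, d]%classic x -> I x.
  rewrite /= in_itv /= -ler_norml => xd; apply: eI.
  rewrite /ball /= sub0r normrN (le_lt_trans xd)// ltr_pdivrMr//.
  by rewrite mulr_natr mulr2n ltrDl.
have hd : {within `[- d, d], continuous h}.
  apply: continuous_in_subspaceT => x /set_mem xd.
  by apply: hc; apply/mem_set/dI.
have hint := continuous_compact_integrable (@segment_compact _ (- d) d) hd.
(* Integrating from [- d] makes 0 interior to the segment, so the fundamental theorem of calculus
   applies on both sides of 0. The additive constant is immaterial. *)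
exists (fun x => (\int[lebesgue_measure]_(t in `[- d, x]) h t)).
have : \forall x \near (0 : R), x \in `]- d, d[%R.
  by apply: near_in_itvoo; rewrite in_itv /= oppr_lt0 d0.
apply: filterS => x; rewrite in_itv /= => /andP[dx xd].
have hx : {for x, continuous h}.
  by apply: hc; apply/mem_set/dI; rewrite /= in_itv /= !ltW.
have [dF eF] := continuous_FTC1_closed xd hint dx hx.
by split; [exact: dF | rewrite -derive1E].
Qed.

Lemma continuous_pair (T U V : topologicalType) (f : T -> U) (g : T -> V) x :
  {for x, continuous f} -> {for x, continuous g} ->
  {for x, continuous (fun y => (f y, g y))}.
Proof. by move=> cf cg; exact: (cvg_pair cf cg). Qed.

Section Coordinates.
Context (R : realType) (a : R) (I : set R) (h : R -> R).
Hypotheses (I_open : open I) (I_0 : I 0) (h_smooth : smooth_on I h).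

Local Notation Phi := (new_variables h).
Local Notation lam := (collinearity_factor h).
Local Notation K := (kukles_of_linear a).
Local Notation L := (linear_of_kukles a).
Local Notation Q := (kukles_denominator a).

Lemma continuous_kukles_of_linear (q : R * R) :
  1 + a * q.2 != 0 -> {for q, continuous K}.
Proof.
move=> m0.
have c1 : (fst : R * R -> R) @ q --> q.1 by exact: cvg_fst.
have c2 : (snd : R * R -> R) @ q --> q.2 by exact: cvg_snd.
have cm : (fun p : R * R => 1 + a * p.2) @ q --> 1 + a * q.2.
  by apply: cvgD; [exact: cvg_cst | apply: cvgM => //; exact: cvg_cst].
have cs : (fun p : R * R => sqnorm p) @ q --> sqnorm q.
  by apply: cvgD; apply: cvgM.
apply: continuous_pair => /=.
  by apply: cvgM => //; exact: cvgV.
apply: cvgM.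
  by apply: cvgN; apply: cvgD => //; apply: cvgM => //; exact: cvg_cst.
by apply: cvgV; [rewrite expf_neq0 | apply: cvgM].
Qed.

Lemma continuous_linear_of_kukles (P : R * R) :
  Q P != 0 -> {for P, continuous L}.
Proof.
move=> m0.
have c1 : (fst : R * R -> R) @ P --> P.1 by exact: cvg_fst.
have c2 : (snd : R * R -> R) @ P --> P.2 by exact: cvg_snd.
have ca : (fun=> a) @ P --> a by exact: cvg_cst.
have cQ : Q @ P --> Q P.
  apply: cvgD; last by apply: cvgM; apply: cvgM.
  by apply: cvgD; [exact: cvg_cst | exact: cvgM].
have cV : (fun p => (Q p)^-1) @ P --> (Q P)^-1 by exact: cvgV.
apply: continuous_pair => /=; first exact: cvgM.
apply: cvgM => //; apply: cvgN; apply: cvgD => //.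
by apply: cvgM => //; apply: cvgM.
Qed.

Lemma continuous_factor (P : R * R) : I P.1 -> {for P, continuous lam}.
Proof.
move=> IP.
have c2 : (snd : R * R -> R) @ P --> P.2 by exact: cvg_snd.
have ch : (fun p : R * R => h p.1) @ P --> h P.1.
  by apply: continuous_cvg; [exact: smooth_continuous IP | exact: cvg_fst].
by apply: cvgB; [exact: cvg_cst | exact: cvgM].
Qed.

Lemma continuous_old_variables (P : R * R) :
  variables_range I h P -> {for P, continuous (old_variables h)}.
Proof.
move=> [IP l0].
apply: continuous_pair => /=; first exact: cvg_fst.
by apply: cvgM; [exact: cvg_snd | apply: cvgV => //; exact: continuous_factor].
Qed.

Lemma continuous_new_variables (p : R * R) :
  variables_domain I h p -> {for p, continuous Phi}.
Proof.
move=> Dp; apply: continuous_pair => /=; first exact: cvg_fst.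
by have [/differentiable_continuous + _] := is_diff_new_variable h_smooth Dp.
Qed.

(** Here [rho] bounds the squared norm. Positivity of [lam], rather than mere nonvanishing, makes
    time strictly increasing in the angle of rotation. *)
Definition good_radius (H : R -> R) (rho : R) : Prop :=
  0 < rho /\ forall q, sqnorm q < rho ->
    [/\ 1 + a * q.2 != 0, I (K q).1, 0 < lam (K q)
      & is_derive (K q).1 (1 : R) H (h (K q).1)].

Lemma kukles_of_linear0 : K (0, 0) = (0, 0).
Proof.
rewrite /kukles_of_linear /sqnorm /= !expr0n /=.
by rewrite addr0 !mulr0 !addr0 oppr0 !mul0r.
Qed.

(** At the origin [K] vanishes while [1 + a v] and lambda equal 1, so all the conditions persist
    nearby by continuity. *)
Lemma good_radius_exists : exists H rho, good_radius H rho.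
Proof.
have [|H Hder] := @primitive_near0 R I h I_open I_0.
  by move=> x /set_mem Ix; exact: smooth_continuous Ix.
have m0 : 1 + a * ((0, 0) : R * R).2 != 0 by rewrite mulr0 addr0 oner_neq0.
have cK := continuous_kukles_of_linear m0.
have cK1 : (fun q => (K q).1) @ (0, 0) --> (0 : R).
  have c1 : (fst : R * R -> R) @ K (0, 0) --> (K (0, 0)).1 by exact: cvg_fst.
  have : (fun q => (K q).1) @ (0, 0) --> (K (0, 0)).1.
    exact: (@continuous_comp _ _ _ K fst _ cK c1).
  by rewrite kukles_of_linear0.
have cl : (fun q => lam (K q)) @ (0, 0) --> (1 : R).
  have -> : 1 = lam (K (0, 0)).
    by rewrite kukles_of_linear0 /collinearity_factor mulr0 subr0.
  apply: continuous_cvg => //.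
  by apply: continuous_factor; rewrite kukles_of_linear0.
have cm : (fun q : R * R => 1 + a * q.2) @ (0, 0) --> (1 : R).
  rewrite -[X in _ --> X]addr0 -[X in _ --> _ + X](mulr0 a).
  apply: cvgD; first exact: cvg_cst.
  by apply: cvgM; [exact: cvg_cst | exact: cvg_snd].
have n1 : \forall q \near (0 : R, 0 : R), 0 < lam (K q).
  exact: (cl [set x | 0 < x] (lt_nbhsr ltr01)).
have n2 : \forall q \near (0 : R, 0 : R), 0 < 1 + a * q.2.
  exact: (cm [set x | 0 < x] (lt_nbhsr ltr01)).
have n3 : \forall q \near (0 : R, 0 : R), I (K q).1.
  exact: (cK1 I (open_nbhs_nbhs (conj I_open I_0))).
have n4 : \forall q \near (0 : R, 0 : R),
    is_derive (K q).1 (1 : R) H (h (K q).1).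
  exact: (cK1 _ Hder).
have : \forall q \near (0 : R, 0 : R),
    [/\ 1 + a * q.2 != 0, I (K q).1, 0 < lam (K q)
      & is_derive (K q).1 (1 : R) H (h (K q).1)].
  near=> q; split.
  - by rewrite gt_eqF//; near: q.
  - by near: q.
  - by near: q.
  - by near: q.
move=> /nbhs_ballP[e /= e0 eP].
(* A ball of the product is a square of half-side [e]; it contains the Euclidean disc of squared
   radius [e^2]. *)
exists H, (e ^+ 2); split; first by rewrite exprn_gt0.
move=> q qe; apply: eP.
split => /=; rewrite /ball /= sub0r normrN.
  rewrite -(@ltr_pXn2r _ 2) ?nnegrE ?(ltW e0)// real_normK ?num_real//.
  by rewrite (le_lt_trans _ qe)// /sqnorm lerDl sqr_ge0.
rewrite -(@ltr_pXn2r _ 2) ?nnegrE ?(ltW e0)// real_normK ?num_real//.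
by rewrite (le_lt_trans _ qe)// /sqnorm lerDr sqr_ge0.
Unshelve. all: by end_near. Qed.

End Coordinates.

Lemma is_derive_continuous (R : realType) (f : R -> R) (x df : R) :
  is_derive x 1 f df -> {for x, continuous f}.
Proof. by case=> /derivable1_diffP/differentiable_continuous. Qed.

Lemma has_period_mul (R : realType) (c : R -> R * R) (T : R) (n : nat) t :
  has_period c T -> c (t + T *+ n) = c t.
Proof.
by case=> _ cT; elim: n => [|n IHn]; rewrite ?mulr0n ?addr0// mulrSr addrA cT.
Qed.

(** * Linearizing coordinates for the original system near the origin *)

Section Orbits.
Context (R : realType) (a : R) (I : set R) (h : R -> R).
Hypotheses (I_open : open I) (h_smooth : smooth_on I h).
Context (H : R -> R) (rho : R).
Hypothesis good : good_radius a I h H rho.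

Local Notation Phi := (new_variables h).
Local Notation lam := (collinearity_factor h).
Local Notation K := (kukles_of_linear a).
Local Notation L := (linear_of_kukles a).
Local Notation Q := (kukles_denominator a).
Local Notation F := (original_system a h).
Local Notation disc := [set q : R * R | sqnorm q < rho].

(* [z] maps the linearizing coordinates (u, v) to (x, y); [w] is its inverse. *)
Let z (q : R * R) : R * R := old_variables h (K q).
Let w (p : R * R) : R * R := L (Phi p).

Lemma disc_range q : disc q -> variables_range I h (K q).
Proof. by move=> /good.2[_ IK l0 _]; split; rewrite ?gt_eqF. Qed.

Lemma disc_domain q : disc q -> variables_domain I h (z q).
Proof. by move=> /disc_range; exact: old_variables_domain. Qed.

Lemma disc_zK q : disc q -> w (z q) = q.
Proof.
move=> dq; rewrite /w /z (old_variablesK (disc_range dq)) kukles_of_linearK//.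
by case: (good.2 _ dq).
Qed.

Lemma disc_denominator q : disc q -> Q (Phi (z q)) != 0.
Proof.
move=> dq; rewrite /z (old_variablesK (disc_range dq)).
by case: (good.2 _ dq) => m0 _ _ _; rewrite kukles_denominator_linear// invr_eq0.
Qed.

Lemma wK p : variables_domain I h p -> Q (Phi p) != 0 -> z (w p) = p.
Proof.
by move=> Dp Q0; rewrite /z /w linear_of_kuklesK// (new_variablesK Dp).
Qed.

Lemma disc_rotation s q : disc q -> disc (rotation s q).
Proof. by rewrite /= sqnorm_rotation. Qed.

Lemma disc0 : disc (0, 0).
Proof. by rewrite /= /sqnorm /= expr0n/= addr0 good.1. Qed.

Lemma z0 : z (0, 0) = (0, 0).
Proof. by rewrite /z kukles_of_linear0 /old_variables /= mul0r. Qed.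

(** * Periods of the solutions that stay in the image of the disc *)

Section Solution.
Variables (c : R -> R * R).
Hypothesis c_sol : solution (phase_space I) F setT c.
Hypothesis c_disc : forall t, (z @` disc) (c t).

Let q t := w (c t).
(** The angle turned, obtained by solving [t = s + H(X)] for [s]; recall that [X = x]. *)
Let sigma t := t - H (c t).1.

Lemma orbit_disc t : disc (q t).
Proof. by have [r dr e] := c_disc t; rewrite /q -e disc_zK. Qed.

Lemma orbitE t : z (q t) = c t.
Proof. by have [r dr e] := c_disc t; rewrite /q -e disc_zK. Qed.

Lemma is_derive_sigma (t : R) :
  is_derive t 1 sigma (1 + h (c t).1 * (c t).2).
Proof.
have [_ d1 _] := c_sol (t := t) Logic.I.
have [_ _ _ dH] := good.2 _ (orbit_disc t).
have e : (K (q t)).1 = (c t).1 by rewrite -[in RHS]orbitE.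
rewrite e in dH.
apply: (is_derive_eq (is_deriveB (is_derive_id t 1) (is_derive1_comp dH d1))).
by rewrite mulrN opprK.
Qed.

(** Dividing the scaled system by lambda leaves the Kukles field with speed [r = 1 / lambda], and
    the linearization carries this speed over to the rotation. *)
Lemma is_derive_orbit (t : R) (r := 1 + h (c t).1 * (c t).2) :
  is_derive t 1 (fun s => (q s).1) (r * (q t).2) /\
  is_derive t 1 (fun s => (q s).2) (- (r * (q t).1)).
Proof.
have Dc s : variables_domain I h (c s).
  by rewrite -orbitE; apply: disc_domain; exact: orbit_disc.
have sol : solution (variables_domain I h) F setT c.
  by move=> s _; have [_ d1 d2] := c_sol (t := s) Logic.I; split.
have [_ d1 d2 e1 e2] :=
  solution_scaled_solution h_smooth (fun s _ => Dc s) sol (t := t) Logic.I.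
have [_ m0] := Dc t.
have li : lam (Phi (c t)) = r^-1 by rewrite (factor_new_variables m0).
have Q0 : Q (Phi (c t)) != 0.
  by rewrite -[c t]orbitE; apply: disc_denominator; exact: orbit_disc.
move: d1 d2 => /derivableP d1 /derivableP d2.
rewrite -derive1E in d1; rewrite -derive1E in d2.
apply: (@is_derive_linear_of_kukles _ _ (Phi \o c)) => //.
- apply: (is_derive_eq d1); rewrite -e1 /= li mulrA mulfV ?mul1r//.
- apply: (is_derive_eq d2); rewrite -e2 /= li mulrA mulfV ?mul1r//.
Qed.

(** The point [q t] turns at the rate [1 + h y], which is also the derivative of [sigma]. Rotating
    it back by [sigma t] therefore gives a curve with zero derivative. *)
Lemma orbit_rotation s t : q t = rotation (sigma t - sigma s) (q s).
Proof.
have cst_rot (x y : R) : rotation (- sigma x) (q x) = rotation (- sigma y) (q y).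
  rewrite [LHS]surjective_pairing [RHS]surjective_pairing.
  have ds (u : R) : is_derive u 1 (fun t => cos (- sigma t))
      (sin (- sigma u) * (1 + h (c u).1 * (c u).2)).
    have dN : is_derive u 1 (fun t => - sigma t) (- (1 + h (c u).1 * (c u).2)).
      exact: is_deriveN (is_derive_sigma u).
    have dcos := is_derive_cos (- sigma u).
    have dC := @is_derive1_comp _ cos (fun t => - sigma t) u _ _ dcos dN.
    apply: (is_derive_eq dC).
    by rewrite mulrNN.
  have dc (u : R) : is_derive u 1 (fun t => sin (- sigma t))
      (- (cos (- sigma u) * (1 + h (c u).1 * (c u).2))).
    have dN : is_derive u 1 (fun t => - sigma t) (- (1 + h (c u).1 * (c u).2)).
      exact: is_deriveN (is_derive_sigma u).
    have dsin := is_derive_sin (- sigma u).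
    have dC := @is_derive1_comp _ sin (fun t => - sigma t) u _ _ dsin dN.
    apply: (is_derive_eq dC).
    by rewrite mulrN.
  congr pair.
  - pose f t := (rotation (- sigma t) (q t)).1.
    apply: (is_derive_0_is_cst (f := f)) => u.
    have [d1 d2] := is_derive_orbit u.
    have e1 := is_deriveM d1 (ds u); have e2 := is_deriveM d2 (dc u).
    apply: (is_derive_eq (is_deriveD e1 e2)).
    by rewrite /GRing.scale /=; ring.
  - pose f t := (rotation (- sigma t) (q t)).2.
    apply: (is_derive_0_is_cst (f := f)) => u.
    have [d1 d2] := is_derive_orbit u.
    have e1 := is_deriveM d2 (ds u); have e2 := is_deriveM d1 (dc u).
    apply: (is_derive_eq (is_deriveB e1 e2)).
    by rewrite /GRing.scale /=; ring.
by rewrite rotationD (cst_rot s t) -rotationD subrr rotation0.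
Qed.

Lemma sigma_period T t : has_period c T -> sigma (t + T) = sigma t + T.
Proof. by case=> _ cT; rewrite /sigma cT addrAC. Qed.

(** Over a period [H(x)] returns to its value, so the angle grows by exactly [T], and rotation by
    [T] fixes the nonzero point [q 0]. *)
Lemma period_ge T : c 0 <> (0, 0) -> has_period c T -> pi *+ 2 <= T.
Proof.
move=> c0 pT; have [T0 cT] := pT.
apply: (@rotation_fix _ _ (q 0)) => //.
  rewrite sqnorm_gt0; apply/eqP => q0; apply: c0.
  by rewrite -orbitE q0 z0.
have := orbit_rotation 0 (0 + T).
have -> : q (0 + T) = q 0 by rewrite /q cT.
by rewrite sigma_period// addrAC subrr add0r => /esym.
Qed.

(** Some multiple of [T] exceeds [2 pi], and [sigma] grows by that multiple, so by the intermediate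
    value theorem it gains [2 pi] at some time [t']. There [c t' = c t], the values of [H] cancel,
    and [t' = t + 2 pi]. *)
Lemma period_2pi T : has_period c T -> has_period c (pi *+ 2).
Proof.
move=> pT; have [T0 cT] := pT.
have pi2 : 0 < pi *+ 2 :> R by rewrite mulrn_wgt0 ?pi_gt0.
split => // t.
pose n := (Num.bound (pi *+ 2 / T)).
have nT : pi *+ 2 <= T *+ n.
  rewrite -[T *+ n]mulr_natl -ler_pdivrMr//.
  by apply/ltW/archi_boundP; rewrite divr_ge0 ?ltW.
have sn : sigma (t + T *+ n) = sigma t + T *+ n.
  by rewrite /sigma (has_period_mul n t pT) addrAC.
have [|||t' _ st'] := @IVT R sigma t (t + T *+ n) (sigma t + pi *+ 2).
- by rewrite lerDl mulrn_wge0 ?ltW.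
- apply: continuous_subspaceT => x.
  exact: is_derive_continuous (is_derive_sigma x).
- have le_sn : sigma t <= sigma t + T *+ n by rewrite lerDl mulrn_wge0 ?ltW.
  by rewrite sn min_l// max_r// lerD2l nT andbT lerDl ltW.
have ct' : c t' = c t.
  rewrite -!orbitE (orbit_rotation t t') st' addrAC subrr add0r.
  by rewrite rotation2pi.
have : t' = t + pi *+ 2.
  by move: st'; rewrite /sigma ct' addrAC => /addIr.
by move=> <-.
Qed.

End Solution.

(** * Construction of a periodic solution through each point of the punctured disc *)

Section Existence.
Variable q0 : R * R.
Hypothesis q0_disc : disc q0.

(** Time as a function of the angle along the circle through [q0], that is, [t = s + H(X)]. Its
    derivative is lambda. *)
Let theta s := s + H (K (rotation s q0)).1.

Lemma is_derive_theta (s : R) :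
  is_derive s 1 theta (lam (K (rotation s q0))).
Proof.
have [m0 _ _ dH] := good.2 _ (disc_rotation s q0_disc).
have d1 : is_derive s 1 (fun x => (rotation x q0).1) (1 * (rotation s q0).2).
  by rewrite mul1r; exact: is_derive_rotation1.
have d2 : is_derive s 1 (fun x => (rotation x q0).2) (- (1 * (rotation s q0).1)).
  by rewrite mul1r; exact: is_derive_rotation2.
have [dX _] := is_derive_kukles_of_linear (q := fun x => rotation x q0) m0 d1 d2.
have dHX := @is_derive1_comp _ H (fun x => (K (rotation x q0)).1) s _ _ dH dX.
apply: (is_derive_eq (is_deriveD (is_derive_id s 1) dHX)).
by rewrite mul1r mulrN.
Qed.

(** This is the source of isochronicity: the correction [H(X)] depends only on the rotated point, so
    it is unchanged by full turns. *)
Lemma thetaD2pi (s : R) (n : nat) :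
  theta (s + (pi *+ 2) *+ n) = theta s + (pi *+ 2) *+ n.
Proof.
have rotn : rotation (s + pi *+ 2 *+ n) q0 = rotation s q0.
  elim: n => [|n IHn]; first by rewrite addr0.
  by rewrite mulrSr addrA addrC rotationD IHn -rotationD addrC rotationD
             rotation2pi.
by rewrite /theta rotn addrAC.
Qed.

Lemma theta_continuous : continuous theta.
Proof. by move=> s; exact: is_derive_continuous (is_derive_theta s). Qed.

Lemma theta_lt (s t : R) : s < t -> theta s < theta t.
Proof.
move=> st.
apply: (@gtr0_derive1_lt_cc _ theta s t) => //.
- by move=> x _; case: (is_derive_theta x).
- move=> x _; rewrite derive1E (@derive_val _ _ _ _ _ _ _ (is_derive_theta x)).
  by case: (good.2 _ (disc_rotation x q0_disc)).
- by apply: continuous_subspaceT; exact: theta_continuous.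
- by rewrite in_itv /= lexx ltW.
- by rewrite in_itv /= lexx ltW.
Qed.

Lemma theta_inj : injective theta.
Proof.
move=> s t e; have [/theta_lt|/theta_lt|//] := ltgtP s t.
  by rewrite e ltxx.
by rewrite e ltxx.
Qed.

(** Whole numbers of turns in either direction move [theta] arbitrarily far from [theta 0]; the
    intermediate value theorem fills the gaps. *)
Lemma theta_surj (y : R) : exists s, theta s = y.
Proof.
have pi2 : 0 < pi *+ 2 :> R by rewrite mulrn_wgt0 ?pi_gt0.
pose n := Num.bound (`|y - theta 0| / (pi *+ 2)).
have nT : `|y - theta 0| <= pi *+ 2 *+ n.
  rewrite -[_ *+ n]mulr_natl -ler_pdivrMr//.
  by apply/ltW/archi_boundP; rewrite divr_ge0// ltW.
have en : theta (pi *+ 2 *+ n) = theta 0 + pi *+ 2 *+ n.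
  by rewrite -[in LHS](add0r (pi *+ 2 *+ n)) thetaD2pi.
have em : theta (- (pi *+ 2 *+ n)) = theta 0 - pi *+ 2 *+ n.
  by rewrite -[in RHS](addNr (pi *+ 2 *+ n)) thetaD2pi addrK.
have n0 : 0 <= pi *+ 2 *+ n :> R by rewrite mulrn_wge0 ?ltW.
have [|||s _ e] := @IVT R theta (- (pi *+ 2 *+ n)) (pi *+ 2 *+ n) y.
- by rewrite (le_trans _ n0)// oppr_le0.
- by apply: continuous_subspaceT; exact: theta_continuous.
- move: nT; rewrite en em ler_norml => /andP[l1 l2].
  rewrite min_l ?max_r; [|lra|lra].
  by apply/andP; split; lra.
by exists s.
Qed.

(** The inverse [tau] of [theta] gives the angle at time [t]. Its derivative [1 / lambda] supplies
    exactly the speed needed for the rotated point to yield a solution of the original system. *)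
Lemma orbit_exists : 0 < sqnorm q0 ->
  exists c, [/\ solution (phase_space I) F setT c, has_period c (pi *+ 2)
    & range c = z @` [set q | sqnorm q = sqnorm q0]].
Proof.
move=> q00.
have [tau tauK] := choice theta_surj.
have thetaK : cancel theta tau by move=> s; exact: theta_inj.
pose p t := rotation (tau t) q0.
have p_disc t : disc (p t) by exact: disc_rotation.
have PhiE : Phi \o (z \o p) = K \o p.
  by apply/funext => t /=; rewrite /z (old_variablesK (disc_range (p_disc t))).
exists (z \o p); split.
- pose r t := (lam (K (p t)))^-1.
  have l0 t : lam (K (p t)) != 0.
    by have [_ _ l0 _] := good.2 _ (p_disc t); rewrite gt_eqF.
  have dtau (t : R) : is_derive t 1 tau (r t).
    rewrite -{1}(tauK t); apply: (@is_derive_inverse _ theta).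
    + by near=> s; exact: thetaK.
    + by near=> s; exact: theta_continuous.
    + exact: is_derive_theta.
    + exact: l0.
  have dp1 (t : R) : is_derive t 1 (fun s => (p s).1) (r t * (p t).2).
    have d := is_derive_rotation1 (tau t) q0.
    apply: (is_derive_eq (@is_derive1_comp _ _ tau t _ _ d (dtau t))).
    by rewrite mulrC.
  have dp2 (t : R) : is_derive t 1 (fun s => (p s).2) (- (r t * (p t).1)).
    have d := is_derive_rotation2 (tau t) q0.
    apply: (is_derive_eq (@is_derive1_comp _ _ tau t _ _ d (dtau t))).
    by rewrite mulNr mulrC.
  have sol : solution (variables_domain I h) F setT (z \o p).
    apply: (scaled_solution_solution h_smooth openT).
      by move=> t _; exact: disc_domain.
    rewrite PhiE => t _.
    have [m0 _ _ _] := good.2 _ (p_disc t).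
    have [dX dY] := is_derive_kukles_of_linear m0 (dp1 t) (dp2 t).
    split.
    + exact: disc_range.
    + by case: dX.
    + by case: dY.
    + rewrite derive1E (@derive_val _ _ _ _ _ _ _ dX).
      exact: (mulVKf (l0 t)).
    + rewrite derive1E (@derive_val _ _ _ _ _ _ _ dY).
      exact: (mulVKf (l0 t)).
  by move=> t Jt; have [[It _] d1 d2] := sol t Jt; split.
- split=> [|t /=]; first by rewrite mulrn_wgt0 ?pi_gt0.
  congr z; rewrite /p.
  (* Since [theta] commutes with the shift by [2 pi], so does its inverse. *)
  have -> : tau (t + pi *+ 2) = tau t + pi *+ 2.
    by apply: theta_inj; rewrite tauK (thetaD2pi (tau t) 1) tauK.
  by rewrite rotationD rotation2pi.
- apply/seteqP; split => [_ [t _ <-]|_ [q /= qq0 <-]].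
    by exists (p t) => //=; rewrite sqnorm_rotation.
  have [s ->] := rotation_transitive q00 qq0.
  by exists (theta s) => //=; rewrite /p thetaK.
Unshelve. all: by end_near. Qed.

End Existence.

(** * Topology of the disc images, and cycles surrounding the origin *)

Lemma open_disc_image r : r <= rho -> open (z @` [set q | sqnorm q < r]).
Proof.
move=> r_rho; rewrite openE => _ [q /= qr <-].
have dq : disc q by exact: lt_le_trans r_rho.
have Dp := disc_domain dq; have [Ip m0] := Dp.
have Q0 := disc_denominator dq.
have c1 : (fst : R * R -> R) @ z q --> (z q).1 by exact: cvg_fst.
have c2 : (snd : R * R -> R) @ z q --> (z q).2 by exact: cvg_snd.
have ch : (fun p : R * R => h p.1) @ z q --> h (z q).1.
  by apply: continuous_cvg => //; exact: smooth_continuous Ip.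
have cm : (fun p : R * R => 1 + h p.1 * p.2) @ z q --> 1 + h (z q).1 * (z q).2.
  by apply: cvgD; [exact: cvg_cst | exact: cvgM].
have cPhi := continuous_new_variables h_smooth Dp.
have cP1 : (fun p => (Phi p).1) @ z q --> (Phi (z q)).1 by [].
have cP2 : (fun p => (Phi p).2) @ z q --> (Phi (z q)).2.
  by apply: cvgM => //; exact: cvgV.
have ca : (fun=> a) @ z q --> a by exact: cvg_cst.
have cQ : (fun p => Q (Phi p)) @ z q --> Q (Phi (z q)).
  apply: cvgD; last by apply: cvgM; apply: cvgM.
  by apply: cvgD; [exact: cvg_cst | exact: cvgM].
(* Openness comes from the continuous inverse: every [p] close to [z q] satisfies [z (w p) = p],
   with [w p] still in the open disc. *)
have cw : {for z q, continuous w}.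
  exact: continuous_comp cPhi (continuous_linear_of_kukles Q0).
have cw1 : (fun p => (w p).1) @ z q --> (w (z q)).1.
  exact: (@continuous_comp _ _ _ w fst _ cw (@cvg_fst _ _ _ _ _)).
have cw2 : (fun p => (w p).2) @ z q --> (w (z q)).2.
  exact: (@continuous_comp _ _ _ w snd _ cw (@cvg_snd _ _ _ _ _)).
have cn : (fun p => sqnorm (w p)) @ z q --> sqnorm (w (z q)).
  by apply: cvgD; apply: cvgM.
rewrite disc_zK// in cn.
have nI : \forall p \near z q, I p.1.
  exact: (c1 I (open_nbhs_nbhs (conj I_open Ip))).
have nm : \forall p \near z q, 1 + h p.1 * p.2 != 0 by exact: cvgr_neq0 cm m0.
have nQ : \forall p \near z q, Q (Phi p) != 0 by exact: cvgr_neq0 cQ Q0.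
have nr : \forall p \near z q, sqnorm (w p) < r.
  exact: (cn [set x | x < r] (lt_nbhsl qr)).
apply: filterS (filterI (filterI nI nm) (filterI nQ nr)) => p [[Ip' mp] [Qp rp]].
by exists (w p) => //; rewrite wK.
Qed.

Lemma compact_closed_disc (r : R) : compact [set q : R * R | sqnorm q <= r].
Proof.
(* From [2 |x| <= x^2 + 1 <= r + 1], the half-side [r + 1] suffices without square roots. *)
apply: (@subclosed_compact _ _ (`[- (r + 1), r + 1] `*` `[- (r + 1), r + 1])).
- apply: (@preimage_closed _ _ (@sqnorm R) [set x | x <= r]).
    move=> q _.
    have c1 : (fst : R * R -> R) @ q --> q.1 by exact: cvg_fst.
    have c2 : (snd : R * R -> R) @ q --> q.2 by exact: cvg_snd.
    by apply: cvgD; apply: cvgM.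
  exact: closed_le.
- by apply: compact_setX; exact: segment_compact.
- move=> [x y]; rewrite /sqnorm /= => xyr.
  have x2 := sqr_ge0 x; have y2 := sqr_ge0 y.
  have x1 := sqr_ge0 (x + 1); have x3 := sqr_ge0 (x - 1).
  have y1 := sqr_ge0 (y + 1); have y3 := sqr_ge0 (y - 1).
  by split => /=; rewrite in_itv /=; apply/andP; split; nra.
Qed.

Lemma compact_disc_image r : r < rho -> compact (z @` [set q | sqnorm q <= r]).
Proof.
move=> r_rho; apply: continuous_compact; last exact: compact_closed_disc.
apply: continuous_in_subspaceT => q /set_mem /= qr.
have dq : disc q by exact: le_lt_trans r_rho.
have [m0 _ _ _] := good.2 _ dq.
apply: continuous_comp; first exact: continuous_kukles_of_linear.
exact: (continuous_old_variables h_smooth (disc_range dq)).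
Qed.

(** A connected set that contains the origin and avoids the image of the circle stays in the image
    of the open disc, whose trace on it is both open and closed. That image is bounded because it
    lies in a compact set. *)
Lemma circle_surrounds r : 0 < r -> r < rho ->
  surrounds (z @` [set q | sqnorm q = r]) (0, 0).
Proof.
move=> r0 r_rho.
have rz q : sqnorm q <= r -> disc q by move=> /= qr; exact: le_lt_trans r_rho.
split.
  move=> [q /= qr q0].
  have : w (z q) = w (z (0, 0)) by rewrite q0 z0.
  rewrite !disc_zK//; [|exact: disc0|by apply: rz; rewrite qr].
  move=> q00; move: r0; rewrite -qr q00.
  by rewrite /sqnorm /= expr0n/= addr0 ltxx.
have cpt := compact_disc_image r_rho.
have W_bounded : bounded_set (z @` [set q | sqnorm q < r]).
  have := compact_bounded cpt; apply: sub_boundedr.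
  by move=> A; apply: subset_trans; apply: image_subset => q /= /ltW.
have := W_bounded; apply: sub_boundedr => A; apply: subset_trans.
move=> p [B [B0 BC B_conn] Bp].
suff BW : B = B `&` (z @` [set q | sqnorm q < r]) by move: Bp; rewrite BW => -[].
apply/esym/B_conn.
- exists (0, 0); split => //; exists (0, 0); last exact: z0.
  by rewrite /= /sqnorm /= expr0n/= addr0.
- exists (z @` [set q | sqnorm q < r]) => //.
  by apply: open_disc_image; exact: ltW.
(* On [B] the open and the closed disc have the same trace, since [B] misses the image of the
   circle. *)
- exists (z @` [set q | sqnorm q <= r]).
    by apply: compact_closed => //; exact: norm_hausdorff.
  apply/seteqP; split => b [Bb [q /= qr e]]; split => //.
    by exists q => //=; exact: ltW.
  exists q => //=; rewrite lt_neqAle qr andbT; apply/eqP => qE.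
  by apply: (BC _ Bb); exists q.
Qed.

(** The image of the disc serves as neighborhood for both claims. Images of circles are the cycles
    through its points; conversely, the period of any cycle inside it is squeezed by [period_ge] and
    [period_2pi]. *)
Lemma origin_isochronous_center :
  I 0 -> isochronous_center (phase_space I) F (0, 0).
Proof.
move=> I_0.
have pi2 : 0 < pi *+ 2 :> R by rewrite mulrn_wgt0 ?pi_gt0.
have U_nbhs : nbhs ((0, 0) : R * R) (z @` disc).
  apply: open_nbhs_nbhs; split; first exact: open_disc_image.
  by exists (0, 0); [exact: disc0 | exact: z0].
split.
  split.
    split => //.
    by rewrite /original_system /=; congr pair; ring.
  exists (z @` disc) => // _ [q0 dq0 <-] q0_neq0.
  have q00 : 0 < sqnorm q0.
    by rewrite sqnorm_gt0; apply/eqP => e; apply: q0_neq0; rewrite e z0.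
  have [c [c_sol c_per c_range]] := orbit_exists dq0 q00.
  have c_circ t : (z @` [set q | sqnorm q = sqnorm q0]) (c t).
    by rewrite -c_range; exists t.
  have circ_disc : z @` [set q | sqnorm q = sqnorm q0] `<=` z @` disc.
    by apply: image_subset => q /= ->.
  exists (pi *+ 2), (z @` [set q | sqnorm q = sqnorm q0]); split => //.
  - exists c; split => //; split => // S perS.
    apply: (period_ge c_sol) perS => [t|c0]; first exact/circ_disc/c_circ.
    by have [] := circle_surrounds q00 dq0; rewrite -c0.
  - by exists q0.
  - exact: circle_surrounds.
exists (pi *+ 2), (z @` disc) => // S C CV [c [c_sol [perS minS] CE]].
have c_disc t : (z @` disc) (c t) by apply: CV; rewrite CE; exists t.
apply/le_anti/andP; split.
  exact: minS (period_2pi c_sol c_disc perS).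
(* A solution starting at the origin would be constant, and then half of its least period would
   again be a period. *)
apply: (period_ge c_sol c_disc _ perS) => c0.
have w0 : w (0, 0) = (0, 0) by rewrite -[X in w X]z0 disc_zK//; exact: disc0.
have c_cst t : c t = (0, 0).
  rewrite -(orbitE c_disc t) (orbit_rotation c_sol c_disc 0 t).
  by rewrite c0 w0 /rotation /= !mul0r addr0 subr0 z0.
have [S0 _] := perS.
have : S <= S / 2 by apply: minS; split => [|t]; rewrite ?divr_gt0// !c_cst.
by rewrite leNgt ltr_pdivrMr// mulr_natr mulr2n ltrDl S0.
Qed.

End Orbits.

Theorem theorem9 (R : realType) (a : R) (I : set R) (h : R -> R)
    (I_open : open I) (I_interval : is_interval I) (I_0 : I 0)
    (h_smooth : smooth_on I h) :
  [/\ takes_collinear_form (new_variables h) (collinearity_factor h)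
        (variables_domain I h) (variables_range I h)
        (original_system a h) (kukles_system a),
      a = 0 ->
        takes_collinear_form (new_variables h) (collinearity_factor h)
          (variables_domain I h) (variables_range I h)
          (original_system a h) (@harmonic_oscillator R)
    & isochronous_center (phase_space I) (original_system a h) (0, 0)].
Proof.
have form := collinear_form a h_smooth.
split; first exact: form.
- move=> a0; have -> : @harmonic_oscillator R = kukles_system a.
    apply/funext => P; rewrite /harmonic_oscillator /kukles_system a0.
    by congr pair; ring.
  exact: form.
- have [H [rho good]] := good_radius_exists a I_open I_0 h_smooth.
  exact: (origin_isochronous_center I_open h_smooth good I_0).
Qed.
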